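(* Let $\mathcal{S}$ be a recognizable and proper substitution on a finite alphabet $\mathcal{A}$ with minimal subshift, and suppose $|\mathcal{S}(\alpha)|>1$ for each $\alpha\in\mathcal{A}$. Let $\lambda$ be the Perron–Frobenius eigenvalue of its substitution matrix. Then $\mathcal{S}$ has a canonical infinite interval exchange transformation $\mathfrak{F}$ for which there is a constant $\kappa\in[0,1)$ such that $$\mathfrak{F}(x)=\lambda\big(\mathfrak{F}(x/\lambda)-\kappa\big)\quad\text{for a.e. }x\in[0,1].$$
   Context: A substitution is proper if there are $\beta,\gamma\in\mathcal{A}$ such that for every $\alpha\in\mathcal{A}$ the word $\mathcal{S}(\alpha)$ begins with $\beta$ and ends with $\gamma$. **Substitutions.** A substitution $\mathcal{S}$ on a finite alphabet $\mathcal{A}$ assigns to each $\alpha\in\mathcal{A}$ a nonempty finite word $\mathcal{S}(\alpha)=\mathcal{S}(\alpha)(0)\,\mathcal{S}(\alpha)(1)\cdots\mathcal{S}(\alpha)(|\mathcal{S}(\alpha)|-1)$ over $\mathcal{A}$; it extends to words by concatenation, which defines $\mathcal{S}^n(\alpha)$. Let $\mathcal{L}$ be the set of all subwords of all words $\mathcal{S}^n(\alpha)$, and let $\Sigma\subset\mathcal{A}^{\mathbb{Z}}$ (product topology) be the set of bi-infinite sequences all of whose finite subwords lie in $\mathcal{L}$. The shift is $(\sigma(\tau))(k)=\tau(k+1)$. The subshift is minimal if every $\sigma$-orbit is dense in $\Sigma$. For $\tau\in\Sigma$, $\mathcal{S}(\tau)=\cdots\mathcal{S}(\tau(-1))\mathcal{S}(\tau(0))\mathcal{S}(\tau(1))\cdots$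 with $\mathcal{S}(\tau(0))$ starting at coordinate $0$. $\mathcal{S}$ is recognizable if for every $\tau\in\Sigma$ there are a unique $\tau'\in\Sigma$ and $0\le k\le|\mathcal{S}(\tau'(0))|-1$ with $\tau=\sigma^k(\mathcal{S}(\tau'))$. Write $[\alpha]=\{\tau\in\Sigma:\tau(0)=\alpha\}$. The substitution matrix $M$ has entry $M_{\alpha\beta}$ equal to the number of occurrences of $\alpha$ in $\mathcal{S}(\beta)$; $\lambda$ is its Perron–Frobenius eigenvalue. **Measure.** $\mu$ is a $\sigma$-invariant Borel probability measure on $\Sigma$. Standing conventions: $\lambda>1$, $\mu([\alpha])>0$ for each $\alpha\in\mathcal{A}$, and $\mu(\mathcal{S}^n([\alpha]))=\mu([\alpha])/\lambda^n$ for all $\alpha\in\mathcal{A}$, $n\ge0$. **Addresses.** Let $\mathsf{A}=\{(\alpha,j):\alpha\in\mathcal{A},\ 0\le j\le|\mathcal{S}(\alpha)|-1\}$ and, for $\alpha\in\mathcal{A}$, $\mathsf{T}(\alpha)=\{(\beta,j)\in\mathsf{A}:\mathcal{S}(\beta)(j)=\alpha\}$. An address is a finite or infinite sequence $((\alpha_1,j_1),(\alpha_2,j_2),\dots)$ in $\mathsf{A}$ with $(\alpha_k,j_k)\in\mathsf{T}(\alpha_{k-1})$ for all $k>1$; $\mathbf{A}_n$ is the set of addresses of length $n$. **Partitions of $[0,1)$.** Choose $\Phi_0:\mathcal{A}\to[0,1)$ so that the intervals $[\Phi_0(\alpha),\Phi_0(\alpha)+\mu([\alpha]))$, $\alpha\in\mathcal{A}$,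 partition $[0,1)$. For each $\alpha\in\mathcal{A}$ choose an ordering of $\mathsf{T}(\alpha)$ and let $\phi:\mathsf{T}(\alpha)\to[0,\mu([\alpha]))$ give the left endpoints of the partition, in that order, of $[0,\mu([\alpha]))$ into intervals $[\phi(\beta,j),\phi(\beta,j)+\mu([\beta])/\lambda)$, $(\beta,j)\in\mathsf{T}(\alpha)$. (Since the sets $\mathsf{T}(\alpha)$ partition $\mathsf{A}$, this defines $\phi$ on $\mathsf{A}$. The orderings are recorded by a dual substitution $\mathcal{S}_*$, where $\mathcal{S}_*(\alpha)$ lists the letters $\beta$ of the elements $(\beta,j)\in\mathsf{T}(\alpha)$ in order.) For $\mathbf{a}=((\alpha_1,j_1),\dots,(\alpha_n,j_n))\in\mathbf{A}_n$ put $$\Phi_n(\mathbf{a})=\Phi_0(\mathcal{S}(\alpha_1)(j_1))+\sum_{k=1}^n\frac{\phi(\alpha_k,j_k)}{\lambda^{k-1}},\qquad \mathbf{I}(\mathbf{a})=\Big[\Phi_n(\mathbf{a}),\Phi_n(\mathbf{a})+\frac{\mu([\alpha_n])}{\lambda^n}\Big).$$ For each $n$ the intervals $\mathbf{I}(\mathbf{a})$, $\mathbf{a}\in\mathbf{A}_n$, partition $[0,1)$, and these partitions are successively refining. **The map $\mathfrak{F}$.** For an address $\mathbf{a}=((\alpha_k,j_k))_k$ let $\mathbf{n}(\mathbf{a})$ be the smallest $k$ with $j_k<|\mathcal{S}(\alpha_k)|-1$ ($\infty$ if there is none). If $\mathbf{n}(\mathbf{a})=N<\infty$, define $\mathcal{V}(\mathbf{a})$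 by replacing $(\alpha_N,j_N)$ with $(\alpha_N,j_N+1)$, replacing the first $N-1$ entries by the unique address $((\beta_1,0),\dots,(\beta_{N-1},0))$ with $\beta_{N-1}=\mathcal{S}(\alpha_N)(j_N+1)$ and $\beta_{k-1}=\mathcal{S}(\beta_k)(0)$, and leaving all entries of index $>N$ unchanged. For $x\in[0,1)$ let $\mathbf{a}(x)$ be the infinite address whose length-$n$ prefix $\mathbf{a}_n(x)$ is, for each $n$, the unique element of $\mathbf{A}_n$ with $x\in\mathbf{I}(\mathbf{a}_n(x))$, and let $\mathbf{n}(x)=\mathbf{n}(\mathbf{a}(x))$. For $x$ with $\mathbf{n}(x)=N<\infty$ (which holds for a.e. $x$) the infinite interval exchange transformation is $$\mathfrak{F}(x)=x-\Phi_N(\mathbf{a}_N(x))+\Phi_N(\mathcal{V}(\mathbf{a}_N(x))).$$ A canonical infinite interval exchange transformation of $\mathcal{S}$ is the map $\mathfrak{F}$ arising from some choice of $\Phi_0$ and of the orderings of the sets $\mathsf{T}(\alpha)$. *)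

(* Defs.v *)
From HB Require Import structures.
From mathcomp Require Import all_boot all_order all_algebra.
From mathcomp Require Import all_classical all_reals all_analysis.
From mathcomp Require Import complex.

Set Implicit Arguments.
Unset Strict Implicit.
Unset Printing Implicit Defensive.

Import Order.TTheory GRing.Theory Num.Theory.
Import numFieldNormedType.Exports.

Local Open Scope classical_set_scope.
Local Open Scope ring_scope.

(* Finite nonempty alphabets.  The distinguished letter is never referred to;
   it is there only because measurable types of the library are pointed. *)
#[short(type="finPointedType")]
HB.structure Definition FinPointed := {T of Finite T & Pointed T}.

(* A^Z with the product of the discrete topologies *)
Notation biseq A := (prod_topology (fun _ : int => discrete_topology A)).

(* A^Z with its Borel sigma-algebra *)
Notation biseq_borel A := (g_sigma_algebraType (@open (biseq A))).

Section Substitution.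
Context {A : finPointedType}.
Variable S : A -> seq A.

Definition is_substitution : Prop := forall a, S a != [::].

Definition proper_subst : Prop :=
  exists b c : A, forall a, exists u v, S a = b :: u /\ S a = rcons v c.

Definition subst_word (w : seq A) : seq A := flatten (map S w).

Definition subst_lang : set (seq A) :=
  [set w | exists n a, infix w (iter n subst_word [:: a])].

(* tau(i) tau(i+1) ... tau(i+n-1) *)
Definition window (tau : int -> A) (i : int) (n : nat) : seq A :=
  mkseq (fun k => tau (i + k%:Z)) n.

Definition subshift : set (int -> A) :=
  [set tau | forall i n, subst_lang (window tau i n)].

Definition shift_seq (k : int) (tau : int -> A) : int -> A :=
  fun i => tau (i + k).

Definition shift_orbit (tau : int -> A) : set (int -> A) :=
  range (fun k : int => shift_seq k tau).

Definition minimal_subshift : Prop :=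
  forall tau, subshift tau -> subshift `<=` @closure (biseq A) (shift_orbit tau).

(* S(tau), with S(tau(0)) starting at coordinate 0.  As the words S(a) are
   nonempty, coordinate n >= 0 lies in S(tau(0) ... tau(n)), which starts at
   coordinate 0, and coordinate -(n+1) = Negz n lies in
   S(tau(-(n+1)) ... tau(-1)), which ends at coordinate -1. *)
Definition subst_seq (tau : int -> A) : int -> A := fun i =>
  match i with
  | Posz n => nth (tau 0) (subst_word (window tau 0 n.+1)) n
  | Negz n => let w := subst_word (window tau (Negz n) n.+1) in
              nth (tau 0) w (size w - n.+1)
  end.

Definition recognizable : Prop :=
  forall tau, subshift tau ->
    exists! p : (int -> A) * nat,
      [/\ subshift p.1, (p.2 <= (size (S (p.1 0))).-1)%N
        & tau = shift_seq p.2%:Z (subst_seq p.1)].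

(* [a] *)
Definition letter_cylinder (a : A) : set (int -> A) :=
  [set tau | subshift tau /\ tau 0 = a].

(* Rows and columns are indexed by the letters through enum_val. *)
Definition subst_matrix (R : realType) : 'M[R]_#|A| :=
  \matrix_(i, j) (count_mem (enum_val i) (S (enum_val j)))%:R.

End Substitution.

(* l is an eigenvalue of M, and no complex eigenvalue has larger modulus. *)
Definition perron_frobenius_eigenvalue (R : realType) (n : nat)
    (M : 'M[R]_n) (l : R) : Prop :=
  eigenvalue M l /\
  forall z : R[i], eigenvalue (map_mx (real_complex R) M) z ->
    `|z| <= real_complex R l.

Definition shift_invariant {R : realType} {A : finPointedType}
    (mu : probability (biseq_borel A) R) : Prop :=
  forall B : set (biseq_borel A), measurable B ->
    mu ((shift_seq 1 : biseq_borel A -> biseq_borel A) @^-1` B) = mu B.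

Section Addresses.
Context {A : finPointedType}.
Variable S : A -> seq A.

(* S(alpha)(j) for p = (alpha, j) *)
Definition letter_at (p : A * nat) : A := nth p.1 (S p.1) p.2.

(* membership in the set of all (alpha, j) with j < |S(alpha)| *)
Definition is_position : pred (A * nat) := fun p => (p.2 < size (S p.1))%N.

(* membership in T(a) *)
Definition is_occurrence (a : A) : pred (A * nat) :=
  fun p => is_position p && (letter_at p == a).

Definition addr_step : rel (A * nat) := fun p q => is_occurrence p.1 q.

Definition address (n : nat) : set (seq (A * nat)) :=
  [set s | [/\ size s = n, all is_position s & sorted addr_step s]].

(* Entries are numbered from 0: e k stands for (alpha_{k+1}, j_{k+1}). *)
Definition inf_address : set (nat -> A * nat) :=
  [set e | forall k, is_position (e k) /\ addr_step (e k) (e k.+1)].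

Definition not_last : pred (A * nat) :=
  fun p => (p.2 < (size (S p.1)).-1)%N.

(* n(e) = m + 1 *)
Definition first_not_last (e : nat -> A * nat) (m : nat) : Prop :=
  not_last (e m) /\ forall k, (k < m)%N -> ~~ not_last (e k).

(* The map V on finite addresses s with n(s) = m + 1 <= size s.  With
   c = S(alpha_{m+1})(j_{m+1} + 1), the letters beta_m, ..., beta_1 are
   c, S(c)(0), S(S(c)(0))(0), ... *)
Definition addr_succ (s : seq (A * nat)) : seq (A * nat) :=
  let m := find not_last s in
  match drop m s with
  | [::] => s
  | (a, j) :: t =>
      let c := letter_at (a, j.+1) in
      [seq (b, 0%N) | b <- rev (traject (fun b => letter_at (b, 0%N)) c m)]
        ++ (a, j.+1) :: t
  end.

Definition ordering_of_occurrences (ord : A -> seq (A * nat)) : Prop :=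
  forall a, uniq (ord a) /\ forall p, (p \in ord a) = is_occurrence a p.

Context {R : realType}.
Variable mu : probability (biseq_borel A) R.
Variable lambda : R.

(* mu([a]) as a real number *)
Definition weight (a : A) : R := fine (mu (letter_cylinder S a)).

Variable Phi0 : A -> R.
Variable ord : A -> seq (A * nat).

Definition letter_partition : Prop :=
  classical_sets.partition [set: A]
    (fun a => `[Phi0 a, Phi0 a + weight a[%classic) `[0, 1[%classic.

(* For p in T(a), phi p is the left endpoint of the interval of p when
   intervals of lengths mu([beta]) / lambda, (beta, j) in T(a), are laid side
   by side from 0 in the order ord a. *)
Definition phi (p : A * nat) : R :=
  let s := ord (letter_at p) in
  \sum_(q <- take (index p s) s) weight q.1 / lambda.

(* Phi_n(s), for n = size s >= 1 *)
Definition Phi (s : seq (A * nat)) : R :=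
  if s is p :: _ then
    Phi0 (letter_at p) + \sum_(k < size s) phi (nth p s k) / lambda ^+ k
  else 0.

(* I(s), for s nonempty *)
Definition addr_interval (s : seq (A * nat)) : set R :=
  if s is p :: t then
    `[Phi s, Phi s + weight (last p t).1 / lambda ^+ size s[%classic
  else set0.

(* e = a(x) *)
Definition address_of (x : R) (e : nat -> A * nat) : Prop :=
  inf_address e /\ forall n, (0 < n)%N -> addr_interval (mkseq e n) x.

(* F(x) is defined and equal to y. *)
Definition iiet_graph (x y : R) : Prop :=
  exists e m, [/\ 0 <= x < 1, address_of x e, first_not_last e m
    & y = x - Phi (mkseq e m.+1) + Phi (addr_succ (mkseq e m.+1))].

(* the points x in [0, 1) with n(x) finite *)
Definition iiet_dom : set R := [set x | exists y, iiet_graph x y].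

(* The value outside iiet_dom is arbitrary. *)
Definition iiet (x : R) : R := xget 0 [set y | iiet_graph x y].

End Addresses.

(* The partial map with domain D given by F on D is a canonical infinite
   interval exchange transformation of S. *)
Definition canonical_iiet {A : finPointedType} (S : A -> seq A)
    {R : realType} (mu : probability (biseq_borel A) R) (lambda : R)
    (D : set R) (F : R -> R) : Prop :=
  exists (Phi0 : A -> R) (ord : A -> seq (A * nat)),
    [/\ letter_partition S mu Phi0,
        ordering_of_occurrences S ord,
        D = iiet_dom S mu lambda Phi0 ord
      & {in D, F =1 iiet S mu lambda Phi0 ord}].

(* Main.v *)
Require Import Defs.
From mathcomp Require Import all_boot all_order all_algebra.
From mathcomp Require Import all_classical all_reals all_analysis.
From mathcomp Require Import zify lra.

Import Order.TTheory GRing.Theory Num.Theory.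
Import numFieldNormedType.Exports.

Local Open Scope classical_set_scope.
Local Open Scope ring_scope.

Set Implicit Arguments.
Unset Strict Implicit.
Unset Printing Implicit Defensive.

(** Let b and c be the common first and last letters of
    the words S(a), and let l be the letter S(alpha_1)(j_1) that an address
    ((alpha_1, j_1), (alpha_2, j_2), ...) starts from.  Prepending
    (l, |S(l)| - 1) to an address makes it one step longer, and since this new
    entry is in last position, the odometer V carries through it: if V maps e
    to e', then V maps the prolonged address to e' preceded by (l', 0), where
    l' is the letter that e' starts from.  So V is self-similar, and it remains
    to choose Phi_0 and the orderings of the T(a) such that both prolongations
    act affinely on [0, 1).

    Stack the letters in an order that begins with c, so that Phi_0(c) = 0, and
    in every T(a) list the last positions first, then the first positions, both
    by letters in the same order as in Phi_0, then all other occurrences.  All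
    last positions lie in T(c) and all first positions in T(b), hence
      phi(l, |S(l)| - 1) = Phi_0(l) / lambda   (phi_last_pos),
      phi(l, 0) = Phi_0(l) / lambda + delta / lambda   (phi_first_pos),
    where delta is 1 if b = c and 0 otherwise.  If x has address e, then the
    first formula says that x / lambda has the address prolonged by
    (l, |S(l)| - 1) (address_div), and the second one says that F(x / lambda)
    is F(x) / lambda + kappa for kappa = Phi_0(b) + delta / lambda
    (iiet_graph_div).

    The equation holds wherever F is defined, which is everywhere on (0, 1):
    if no entry of the address of x can be increased, then all entries are
    (c, |S(c)| - 1), whose offsets phi vanish, so that x = 0
    (all_last_eq0).

    That every x has exactly one address rests on the intervals of T(a) filling
    the interval of a, i.e. on mu([a]) being the sum of mu([beta]) / lambda
    over (beta, j) in T(a) (sum_occurrences).  By recognizability [a] is the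
    disjoint union of the sets sigma^j(S([beta])); these are compact, being
    continuous images of a compact set, hence Borel, and shift invariance
    gives them the measure of S([beta]). *)

(** * Intervals laid side by side *)

Section Offset.
Context {T : eqType} {R : realDomainType}.
Variable f : T -> R.

(** The left endpoint of the interval of x when intervals of lengths f are laid
    side by side from 0 in the order s; it gives both Phi_0 and phi. *)
Definition offset (s : seq T) (x : T) : R := \sum_(q <- take (index x s) s) f q.

Lemma offset_cons y s x :
  offset (y :: s) x = if y == x then 0 else f y + offset s x.
Proof. by rewrite /offset /=; case: ifP; rewrite ?big_nil // big_cons. Qed.

(** Peel off the first interval: either it contains r, or r minus its length is
    covered by the remaining ones. *)
Lemma offset_cover (s : seq T) (r : R) :
  uniq s -> 0 <= r < \sum_(q <- s) f q ->
  exists2 x, x \in s & offset s x <= r < offset s x + f x.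
Proof.
elim: s r => [|y s IHs] r /=; first by move=> _; rewrite big_nil; lra.
case/andP=> ys us; rewrite big_cons => rs.
have [ry|ry] := ltP r (f y).
  by exists y; rewrite ?mem_head // offset_cons eqxx add0r ry; lra.
have [|x xs rx] := IHs (r - f y) us; first by lra.
exists x; first by rewrite in_cons xs orbT.
by rewrite offset_cons; case: eqP => [yx|_]; [rewrite yx xs in ys|lra].
Qed.

Hypothesis f_ge0 : forall x, 0 <= f x.

Lemma offset_ge0 s x : 0 <= offset s x.
Proof. exact: sumr_ge0. Qed.

Lemma offset_le_sum (s : seq T) x :
  x \in s -> offset s x + f x <= \sum_(q <- s) f q.
Proof.
elim: s => [//|y s IHs]; rewrite in_cons offset_cons big_cons eq_sym.
case: eqP => [<- _|_ /= /IHs]; last by lra.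
by rewrite add0r lerDl sumr_ge0.
Qed.

Lemma offset_inj (s : seq T) x y r : x \in s -> y \in s ->
  offset s x <= r < offset s x + f x -> offset s y <= r < offset s y + f y ->
  x = y.
Proof.
elim: s r => [//|z s IHs] r; rewrite !in_cons !offset_cons ![z == _]eq_sym.
have := offset_ge0 s x; have := offset_ge0 s y.
case: eqP => [<-|_]; case: eqP => [<-|_] //= oy ox xs ys rx ry.
- by exfalso; lra.
- by exfalso; lra.
apply: (IHs (r - f z)) => //; lra.
Qed.

End Offset.

Section OffsetOperations.
Context {R : realDomainType}.

Lemma offset_cat (T : eqType) (f : T -> R) s1 s2 x :
  offset f (s1 ++ s2) x =
    if x \in s1 then offset f s1 x else \sum_(q <- s1) f q + offset f s2 x.
Proof.
elim: s1 => [|y s1 IHs] /=; first by rewrite big_nil add0r.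
rewrite !offset_cons in_cons eq_sym IHs big_cons.
by case: eqP => //= _; case: ifP => // _; rewrite addrA.
Qed.

Lemma offset_map (T U : eqType) (h : T -> U) (f : U -> R) s x :
  injective h -> offset f (map h s) (h x) = offset (f \o h) s x.
Proof. by move=> h_inj; rewrite /offset index_map // -map_take big_map. Qed.

Lemma offsetM (T : eqType) (f : T -> R) k s x :
  offset (fun q => f q * k) s x = offset f s x * k.
Proof. by rewrite /offset mulr_suml. Qed.

End OffsetOperations.

(** * Addresses of points *)

Section Address.
Context {A : finPointedType} {R : realType}.
Variable S : A -> seq A.
Variable mu : probability (biseq_borel A) R.
Variable lambda : R.
Variable Phi0 : A -> R.
Variable ord : A -> seq (A * nat).

Local Notation w := (weight S mu).
Local Notation phi := (phi S mu lambda ord).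
Local Notation Phi := (Phi S mu lambda Phi0 ord).
Local Notation addr_interval := (addr_interval S mu lambda Phi0 ord).
Local Notation address_of := (address_of S mu lambda Phi0 ord).

Hypothesis lambda_gt0 : 0 < lambda.
Hypothesis w_ge0 : forall a, 0 <= w a.
Hypothesis Phi0_partition : letter_partition S mu Phi0.
Hypothesis ord_ordering : ordering_of_occurrences S ord.
Hypothesis sum_ord : forall a, \sum_(q <- ord a) w q.1 / lambda = w a.

(** Subtracting from x the left endpoint given by the first n entries of e and
    rescaling by lambda ^ n turns membership of x in nested intervals into a
    single recursion (residualS): the residual lies in [0, w(l)), l being the
    current letter, and choosing the next entry amounts to locating it among the
    intervals of T(l). *)
Definition residual (e : nat -> A * nat) (x : R) (n : nat) : R :=
  lambda ^+ n *
    (x - Phi0 (letter_at S (e 0%N)) - \sum_(k < n) phi (e k) / lambda ^+ k).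

Lemma residual0 e x : residual e x 0 = x - Phi0 (letter_at S (e 0%N)).
Proof. by rewrite /residual big_ord0 expr0 mul1r subr0. Qed.

Lemma residualS e x n :
  residual e x n.+1 = lambda * (residual e x n - phi (e n)).
Proof.
rewrite /residual big_ord_recr /= exprS -mulrA; congr (_ * _).
rewrite opprD addrA mulrBr; congr (_ - _).
by rewrite mulrCA mulfV ?mulr1 // expf_neq0 // gt_eqF.
Qed.

Lemma Phi_mkseq e n : Phi (mkseq e n.+1)
  = Phi0 (letter_at S (e 0%N)) + \sum_(k < n.+1) phi (e k) / lambda ^+ k.
Proof.
rewrite -[LHS]/(Phi0 (letter_at S (e 0%N)) + \sum_(k < size (mkseq e n.+1))
  phi (nth (e 0%N) (mkseq e n.+1) k) / lambda ^+ k) size_mkseq.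
congr (_ + _); by apply: eq_bigr => k _; rewrite nth_mkseq.
Qed.

Lemma addr_interval_mkseq e n x :
  addr_interval (mkseq e n.+1) x <-> 0 <= residual e x n.+1 < w (e n).1.
Proof.
rewrite -[addr_interval _]/(`[Phi (mkseq e n.+1), Phi (mkseq e n.+1) +
  w (last (e 0%N) (mkseq e n.+1)).1 / lambda ^+ size (mkseq e n.+1)[%classic).
rewrite [X in last _ X]mkseqS last_rcons size_mkseq Phi_mkseq /= in_itv /=.
rewrite /residual -(addrA x) -opprD.
set y := Phi0 _ + _.
have l0 : 0 < lambda ^+ n.+1 by rewrite exprn_gt0.
by rewrite pmulr_rge0 // subr_ge0 -ltrBlDl ltr_pdivlMr // [_ * lambda ^+ _]mulrC.
Qed.

Lemma ord_wf p : is_position S p -> p \in ord (letter_at S p).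
Proof. by move=> pp; rewrite (ord_ordering _).2 /is_occurrence pp eqxx. Qed.

Let wl_ge0 (q : A * nat) : 0 <= w q.1 / lambda.
Proof. by rewrite divr_ge0 // ltW. Qed.

Lemma phi_ge0 p : 0 <= phi p.
Proof. exact: offset_ge0. Qed.

Lemma phi_le p : is_position S p -> phi p + w p.1 / lambda <= w (letter_at S p).
Proof. by move=> /ord_wf/(offset_le_sum wl_ge0); rewrite sum_ord. Qed.

Lemma letter_eq a a' r : Phi0 a <= r < Phi0 a + w a ->
  Phi0 a' <= r < Phi0 a' + w a' -> a = a'.
Proof.
case: Phi0_partition => _ /(_ a a') triv _ ra ra'; apply: triv => //.
by exists r; split; rewrite /= in_itv.
Qed.

(** The interval condition at depth n + 1 read one step earlier: the entry e n is
    the one whose interval contains the n-th residual. *)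
Lemma residual_itv e x : address_of x e -> forall n,
  phi (e n) <= residual e x n < phi (e n) + w (e n).1 / lambda.
Proof.
move=> [_ xe] n; have /addr_interval_mkseq := xe n.+1 isT.
rewrite residualS pmulr_rge0 // subr_ge0 => /andP[-> /=].
by rewrite -ltrBlDl ltr_pdivlMr // mulrC.
Qed.

Lemma first_letter_itv e x : address_of x e ->
  Phi0 (letter_at S (e 0%N)) <= x
    < Phi0 (letter_at S (e 0%N)) + w (letter_at S (e 0%N)).
Proof.
move=> xe; have := residual_itv xe 0; rewrite residual0.
have := phi_ge0 (e 0%N); have := phi_le (xe.1 0%N).1; lra.
Qed.

(** Two addresses of x start from the same letter, since the intervals of Phi_0
    are disjoint.  As long as letters and residuals agree, disjointness of the
    intervals of T(l) forces the same next entry, hence the same next letter and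
    residual. *)
Lemma address_unique x e e' : address_of x e -> address_of x e' -> e =1 e'.
Proof.
move=> xe xe'.
have inv n : letter_at S (e n) = letter_at S (e' n) /\
    residual e x n = residual e' x n -> e n = e' n.
  move=> [le re]; have := residual_itv xe' n; have := residual_itv xe n.
  rewrite -re /Defs.phi -le => h h'.
  have /ord_wf o := (xe.1 n).1; have /ord_wf o' := (xe'.1 n).1.
  by rewrite -le in o'; exact: offset_inj h h'.
move=> n; apply: (inv); elim: n => [|n [IH1 IH2]].
  have le := letter_eq (first_letter_itv xe) (first_letter_itv xe').
  by rewrite !residual0 le.
have en := inv n (conj IH1 IH2); split; last by rewrite !residualS IH2 en.
have /andP[_ /eqP ->] := (xe.1 n).2; have /andP[_ /eqP ->] := (xe'.1 n).2.
by rewrite en.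
Qed.

(** Iterate the choice of the entry whose interval contains the residual; it is
    always possible because the intervals of T(l) fill [0, w(l)). *)
Lemma address_exists x : 0 <= x < 1 -> exists e, address_of x e.
Proof.
move=> x01.
have [a0 a0x] : exists a, Phi0 a <= x < Phi0 a + w a.
  case: Phi0_partition => + _ _ => /seteqP[_ /(_ x)].
  by rewrite /= in_itv /= => /(_ x01)[a _ /=]; rewrite in_itv; exists a.
have /choice[f fP] : forall ar : A * R, exists p, 0 <= ar.2 < w ar.1 ->
    [/\ is_position S p, letter_at S p = ar.1
      & 0 <= lambda * (ar.2 - phi p) < w p.1].
  move=> [a r] /=; have [ra|] := boolP (0 <= r < w a); last by exists (a, 0%N).
  have rs : 0 <= r < \sum_(q <- ord a) w q.1 / lambda by rewrite sum_ord.
  have [p po rp] := offset_cover (ord_ordering a).1 rs.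
  have := po; rewrite (ord_ordering a).2 => /andP[pp /eqP pa].
  exists p => _; split => //; move: rp; rewrite -{1 2}pa.
  rewrite -/(phi p) pmulr_rge0 // subr_ge0 => /andP[-> /=].
  by rewrite -ltrBlDl ltr_pdivlMr // mulrC.
pose st n := iter n
  (fun ar => ((f ar).1, lambda * (ar.2 - phi (f ar)))) (a0, x - Phi0 a0).
pose e n := f (st n).
have stP n : 0 <= (st n).2 < w (st n).1.
  elim: n => [|n IHn] /=; first by rewrite subr_ge0 ltrBlDl.
  by have [_ _] := fP _ IHn.
have stE n : letter_at S (e n) = (st n).1 by have [_ ->] := fP _ (stP n).
have resE n : residual e x n = (st n).2.
  elim: n => [|n IHn]; first by rewrite residual0 stE.
  by rewrite residualS IHn.
exists e; split.
  move=> k; have [pk _ _] := fP _ (stP k); have [pk' lk' _] := fP _ (stP k.+1).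
  by split => //; rewrite /addr_step /is_occurrence pk' lk' eqxx.
by case=> // n _; rewrite addr_interval_mkseq resE; exact: stP n.+1.
Qed.

End Address.

(** * The self-similar choice of partitions *)

Lemma exp_unbounded {R : archiRealFieldType} (l x y : R) :
  1 < l -> 0 < x -> exists n, y < l ^+ n * x.
Proof.
move=> l1 x0.
have l10 : 0 < l - 1 by rewrite subr_gt0.
have bernoulli n : n%:R * (l - 1) <= l ^+ n.
  elim: n => [|n IHn]; first by rewrite mul0r expr0.
  have : 1 <= l ^+ n by rewrite exprn_ege1 // ltW.
  rewrite exprS -natr1; nra.
have := archi_boundP (normr_ge0 (y / x / (l - 1))).
set n := Num.bound _ => nP; exists n.
rewrite -ltr_pdivrMr //; apply: lt_le_trans (bernoulli n).
by rewrite -ltr_pdivrMr //; apply: le_lt_trans nP; exact: ler_norm.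
Qed.

Section Canonical.
Context {A : finPointedType} {R : realType}.
Variable S : A -> seq A.
Variable mu : probability (biseq_borel A) R.
Variable lambda : R.
Variables b c : A.

Local Notation w := (weight S mu).

Hypothesis S_size : forall a, (1 < size (S a))%N.
Hypothesis S_first : forall a, letter_at S (a, 0%N) = b.
Hypothesis S_last : forall a, letter_at S (a, (size (S a)).-1) = c.
Hypothesis lambda_gt1 : 1 < lambda.
Hypothesis w_gt0 : forall a, 0 < w a.
Hypothesis sum_w : \sum_a w a = 1.

Definition first_pos (a : A) : A * nat := (a, 0%N).
Definition last_pos (a : A) : A * nat := (a, (size (S a)).-1).

(** Starting with c makes x / lambda, which lies in [0, 1 / lambda), fall into
    the intervals of the last positions, stacked from Phi_0(c) = 0. *)
Definition letters_from : seq A := c :: rem c (enum A).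

(** One common list, of which every T(a) inherits its order; this treats the
    cases b = c and b <> c alike. *)
Definition positions : seq (A * nat) :=
  map last_pos letters_from ++ map first_pos letters_from ++
  [seq (a, j) | a <- letters_from, j <- iota 1 (size (S a)).-2].

Definition sorted_occurrences (a : A) : seq (A * nat) :=
  [seq p <- positions | letter_at S p == a].

Definition stacked : A -> R := offset w letters_from.

Local Notation ord := sorted_occurrences.
Local Notation phi := (phi S mu lambda ord).
Local Notation Phi := (Phi S mu lambda stacked ord).
Local Notation address_of := (address_of S mu lambda stacked ord).
Local Notation iiet_graph := (iiet_graph S mu lambda stacked ord).

Let lambda_gt0 : 0 < lambda. Proof. exact: lt_trans ltr01 lambda_gt1. Qed.
Let w_ge0 a : 0 <= w a. Proof. exact: ltW. Qed.

Lemma letters_from_perm : perm_eq letters_from (enum A).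
Proof. by rewrite perm_sym perm_to_rem ?mem_enum. Qed.

Lemma letters_from_uniq : uniq letters_from.
Proof. by rewrite (perm_uniq letters_from_perm) enum_uniq. Qed.

Lemma mem_letters_from a : a \in letters_from.
Proof. by rewrite (perm_mem letters_from_perm) mem_enum. Qed.

Lemma sum_letters_from : \sum_(a <- letters_from) w a = 1.
Proof. by rewrite (perm_big _ letters_from_perm) big_enum. Qed.

Lemma first_pos_inj : injective first_pos.
Proof. by move=> a a' []. Qed.

Lemma last_pos_inj : injective last_pos.
Proof. by move=> a a' []. Qed.

Lemma mem_positions p : (p \in positions) = is_position S p.
Proof.
case: p => a j; rewrite -[RHS]/(j < size (S a))%N mem_cat mem_cat.
have sa := S_size a.
apply/idP/idP.
  case/or3P.
  - by case/mapP => a' _ [-> ->]; rewrite prednK // (ltn_trans _ (S_size a')).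
  - by case/mapP => a' _ [-> ->]; rewrite (ltn_trans _ (S_size a')).
  move=> /allpairsPdep[a' [j' [_ + [-> ->]]]].
  rewrite mem_iota; have := S_size a'; case: (size _) => [|[|n]] // _ /andP[_].
  by rewrite add1n => /leq_trans; apply.
move=> ja; case: j ja => [|j] ja.
  by rewrite (map_f first_pos (mem_letters_from a)) orbT.
have [jl|jl] := eqVneq j.+1 (size (S a)).-1.
  by rewrite jl (map_f last_pos (mem_letters_from a)).
apply/or3P/Or33/allpairsPdep; exists a, j.+1; split => //.
  exact: mem_letters_from.
rewrite mem_iota; move: ja jl sa; case: (size _) => [|[|n]] //=.
by rewrite add1n !ltnS leq_eqVlt => /orP[/eqP->|//]; rewrite eqxx.
Qed.

Lemma positions_uniq : uniq positions.
Proof.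
rewrite cat_uniq cat_uniq has_cat negb_or -!all_predC.
rewrite (map_inj_uniq last_pos_inj) (map_inj_uniq first_pos_inj).
rewrite letters_from_uniq !andTb.
rewrite -andbA; apply/and4P; split.
- apply/allP => _ /mapP[a _ ->]; apply/mapP => -[a' _ [_ /esym]].
  by have := S_size a'; case: (size _) => [|[|n]].
- apply/allP => _ /allpairsPdep[a [j [_ + ->]]]; rewrite mem_iota => ja.
  apply/mapP => -[a' _ [aa' jl]]; move: ja; rewrite jl -aa'.
  by have := S_size a; case: (size _) => [|[|n]] //= _; rewrite add1n ltnn.
- apply/allP => _ /allpairsPdep[a [j [_ + ->]]].
  by rewrite mem_iota => ja; apply/mapP => -[a' _ [_ j0]]; rewrite j0 in ja.
- apply: allpairs_uniq_dep => //.
  + exact: letters_from_uniq.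
  + by move=> a _; exact: iota_uniq.
  by move=> [a j] [a' j'] _ _ /= [-> ->].
Qed.

Lemma sorted_occurrences_ordering : ordering_of_occurrences S ord.
Proof.
move=> a; split; first by rewrite filter_uniq // positions_uniq.
by move=> p; rewrite mem_filter mem_positions andbC.
Qed.

Lemma stacked_partition : letter_partition S mu stacked.
Proof.
split.
- apply/seteqP; split => x /=.
    move=> [a _ /=]; rewrite !in_itv /= => /andP[ax xa].
    have := offset_le_sum w_ge0 (mem_letters_from a).
    have := offset_ge0 w_ge0 letters_from a.
    by rewrite sum_letters_from -/(stacked a); lra.
  rewrite in_itv /= => x01.
  have [||a _ ax] := @offset_cover _ _ w letters_from x.
  + exact: letters_from_uniq.
  + by rewrite sum_letters_from.
  by exists a => //=; rewrite in_itv.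
- move=> a a' _ _ [x []] /=; rewrite !in_itv /= => ax a'x.
  exact: (offset_inj (f := w) w_ge0 (mem_letters_from a) (mem_letters_from a') ax a'x).
- move=> a _; exists (stacked a) => /=.
  by rewrite in_itv /= lexx ltrDl w_gt0.
Qed.

Lemma stacked_last : stacked c = 0.
Proof. by rewrite /stacked offset_cons eqxx. Qed.

(** All last positions are occurrences of c, so they form an initial segment of
    the ordering of T(c) and do not appear in any other T(a). *)
Lemma filter_last a : [seq p <- map last_pos letters_from | letter_at S p == a]
  = if c == a then map last_pos letters_from else [::].
Proof.
rewrite filter_map (eq_filter (a2 := fun=> c == a)).
  by case: (c == a); rewrite ?filter_predT ?filter_pred0.
by move=> x /=; rewrite S_last.
Qed.

Lemma filter_first a : [seq p <- map first_pos letters_from | letter_at S p == a]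
  = if b == a then map first_pos letters_from else [::].
Proof.
rewrite filter_map (eq_filter (a2 := fun=> b == a)).
  by case: (b == a); rewrite ?filter_predT ?filter_pred0.
by move=> x /=; rewrite S_first.
Qed.

Lemma phi_last_pos a : phi (last_pos a) = stacked a / lambda.
Proof.
rewrite -[LHS]/(offset (fun q => w q.1 / lambda) _ _) S_last.
rewrite /ord /positions filter_cat filter_last eqxx offset_cat.
rewrite map_f ?mem_letters_from //.
by rewrite (offset_map _ _ _ last_pos_inj) offsetM.
Qed.

(** The first positions head the ordering of T(b), except that for b = c the last
    positions, of total length 1 / lambda, precede them. *)
Lemma phi_first_pos a :
  phi (first_pos a) = stacked a / lambda + (c == b)%:R / lambda.
Proof.
rewrite -[LHS]/(offset (fun q => w q.1 / lambda) _ _) S_first.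
rewrite /ord /positions !filter_cat filter_last offset_cat ifF; last first.
  case: (c == b) => //; apply/mapP => -[a' _ [_ /esym]].
  by have := S_size a'; case: (size _) => [|[|n]].
rewrite addrC offset_cat filter_first eqxx map_f ?mem_letters_from //.
rewrite (offset_map _ _ _ first_pos_inj) offsetM; congr (_ + _).
case: (c == b); last by rewrite big_nil mul0r.
by rewrite big_map -mulr_suml sum_letters_from.
Qed.

Hypothesis sum_ord : forall a, \sum_(q <- ord a) w q.1 / lambda = w a.

Let ord_ordering := sorted_occurrences_ordering.
Let Phi0_partition := stacked_partition.

Local Notation residual := (residual S mu lambda stacked ord).

(** If every entry is in last position, then every letter of the address is c, so
    every entry is (c, |S(c)| - 1) and has offset 0: the residuals are
    lambda ^ n * x, and they stay bounded only for x = 0. *)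
Lemma all_last_eq0 x e : address_of x e ->
  (forall k, ~~ not_last S (e k)) -> x = 0.
Proof.
move=> xe e_last.
have eE k : e k = last_pos (e k).1.
  have := e_last k; have := (xe.1 k).1; rewrite /not_last /is_position.
  case: (e k) => a j /= ja; rewrite -leqNgt /last_pos => aj; congr (_, _).
  by apply/eqP; rewrite eqn_leq aj andbT -ltnS prednK // (leq_trans _ ja).
have lc k : letter_at S (e k) = c by rewrite eE S_last.
have e1 k : (e k).1 = c.
  by have /andP[_ /eqP <-] := (xe.1 k).2; rewrite lc.
have res n : residual e x n = lambda ^+ n * x.
  elim: n => [|n IHn].
    by rewrite residual0 lc stacked_last subr0 expr0 mul1r.
  by rewrite residualS // IHn eE e1 phi_last_pos stacked_last mul0r subr0 exprS mulrA.
have itv n : 0 <= lambda ^+ n * x < w c / lambda.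
  have := residual_itv lambda_gt0 xe n.
  by rewrite res eE e1 phi_last_pos stacked_last mul0r add0r.
have := itv 0%N; rewrite expr0 mul1r le0r => /andP[/orP[/eqP//|x0] _].
have [n] := exp_unbounded (w c / lambda) lambda_gt1 x0.
by have := itv n; lra.
Qed.

Lemma first_not_last_exists x e : address_of x e -> x != 0 ->
  exists m, first_not_last S e m.
Proof.
move=> xe x0; have [k ek] : exists k, not_last S (e k).
  apply: contrapT => /forallNP eN; case/eqP: x0; apply: (all_last_eq0 xe) => k.
  by apply/negP; exact: eN.
have exk : exists k, not_last S (e k) by exists k.
exists (ex_minn exk); case: ex_minnP => m em min_m; split=> // i im.
by apply/negP => /min_m; rewrite leqNgt im.
Qed.

Lemma first_not_last_unique (e : nat -> A * nat) m m' :
  first_not_last S e m -> first_not_last S e m' -> m = m'.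
Proof.
move=> [em em_min] [em' em'_min]; apply/eqP; rewrite eqn_leq.
apply/andP; split; rewrite leqNgt; apply/negP.
  by move/em_min/negP; apply; exact: em'.
by move/em'_min/negP; apply; exact: em.
Qed.

Lemma iiet_graph_unique x y y' : iiet_graph x y -> iiet_graph x y' -> y = y'.
Proof.
move=> [e [m [_ xe em ->]]] [e' [m' [_ xe' em' ->]]].
have ee' : e = e'.
  apply/funext.
  exact: address_unique lambda_gt0 w_ge0 Phi0_partition ord_ordering sum_ord
    _ _ _ xe xe'.
by move: em'; rewrite -ee' => /(first_not_last_unique em) ->.
Qed.

Definition address_cons (p : A * nat) (e : nat -> A * nat) : nat -> A * nat :=
  fun n => if n is k.+1 then e k else p.

(** The first residual of x / lambda along the prolonged address is
    lambda * (x / lambda - phi (last_pos l)) = x - Phi_0(l), which is the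
    initial residual of x; from there on the two recursions coincide. *)
Lemma address_div x e : address_of x e ->
  address_of (x / lambda) (address_cons (last_pos (letter_at S (e 0%N))) e).
Proof.
move=> xe; set l := letter_at S (e 0%N).
have res n : residual (address_cons (last_pos l) e) (x / lambda) n.+1
    = residual e x n.
  elim: n => [|n IHn]; rewrite residualS // ?IHn ?residualS //.
  rewrite !residual0 /= S_last stacked_last subr0 phi_last_pos -mulrBl.
  by rewrite mulrCA mulfV ?mulr1 ?gt_eqF.
split.
  move=> [|k] /=; last exact: xe.1.
  split; first by rewrite /is_position /= prednK // (ltn_trans _ (S_size l)).
  by rewrite /addr_step /is_occurrence (xe.1 0%N).1 eqxx.
case=> // n _; apply/addr_interval_mkseq => //; rewrite res.
case: n => [|n] /=; last by apply/addr_interval_mkseq => //; exact: xe.2.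
rewrite residual0 subr_ge0 ltrBlDl.
exact: first_letter_itv xe.
Qed.

Lemma first_not_last_cons (e : nat -> A * nat) l m :
  first_not_last S e m -> first_not_last S (address_cons (last_pos l) e) m.+1.
Proof.
move=> [em em_min]; split => // -[|k] km /=; last exact: em_min.
by rewrite /not_last ltnn.
Qed.

Lemma Phi_cons p q s : Phi (p :: q :: s) = stacked (letter_at S p) + phi p
  + (Phi (q :: s) - stacked (letter_at S q)) / lambda.
Proof.
rewrite /Defs.Phi big_ord_recl /= expr0 divr1 addrA; congr (_ + _).
rewrite [_ + _ - _]addrC addKr mulr_suml; apply: eq_bigr => k _.
rewrite /= (set_nth_default q); last exact: ltn_ord.
by rewrite exprS invfM mulrCA mulrC.
Qed.

(** The carry passes through the prepended last position and resets it.  The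
    letters of the reset entries are read backwards from the increased entry, so
    one more reset entry means one more term of the same iteration. *)
Lemma addr_succ_cons l s : has (not_last S) s ->
  addr_succ S (last_pos l :: s) =
    first_pos (letter_at S (head (l, 0%N) (addr_succ S s))) :: addr_succ S s.
Proof.
move=> s_nl; have l_last : not_last S (last_pos l) = false by rewrite /not_last ltnn.
rewrite /addr_succ [find _ (_ :: _)]/= l_last [drop _ (_ :: _)]/=.
have := s_nl; rewrite has_find; set m := find _ s => ms.
have := drop_nth (l, 0%N) ms.
case: (drop m s) => // -[a j] t _.
set f := (fun b0 : A => letter_at S (b0, 0%N)); set d := letter_at S (a, _).
have -> : rev (traject f d m.+1) = iter m f d :: rev (traject f d m).
  by rewrite trajectSr rev_rcons.
rewrite /= -/(first_pos _); congr (first_pos _ :: _).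
case: {+}m => [//|k]; by rewrite trajectSr rev_rcons.
Qed.

Lemma addr_succ_neq0 s : s != [::] -> addr_succ S s != [::].
Proof.
rewrite /addr_succ; case: (drop _ s) => // -[a j] t _.
by case: [seq _ | _ <- _].
Qed.

(** The left endpoint of the block of the intervals of all first positions. *)
Definition kappa : R := stacked b + (c == b)%:R / lambda.

Lemma kappa_itv : 0 <= kappa < 1.
Proof.
rewrite /kappa; have [<-|_] := eqVneq c b.
  rewrite stacked_last add0r div1r invr_ge0 ltW //= invf_lt1 //.
rewrite mul0r addr0 (offset_ge0 w_ge0) /=.
have := offset_le_sum w_ge0 (mem_letters_from b).
by rewrite sum_letters_from; have := w_gt0 b; rewrite -/(stacked b); lra.
Qed.

(** Prolonging s by (l, |S(l)| - 1) divides Phi(s) by lambda, and prolonging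
    V(s) by (l', 0) divides Phi(V(s)) by lambda and adds kappa. *)
Lemma iiet_graph_div x y : iiet_graph x y ->
  iiet_graph (x / lambda) (y / lambda + kappa).
Proof.
move=> [e [m [x01 xe em ->]]]; set l := letter_at S (e 0%N).
exists (address_cons (last_pos l) e), m.+1; split.
- have /andP[x0 x1] := x01; rewrite (divr_ge0 x0 (ltW lambda_gt0)) /= ltr_pdivrMr // mul1r.
  exact: lt_trans x1 lambda_gt1.
- exact: address_div.
- exact: first_not_last_cons.
have -> : mkseq (address_cons (last_pos l) e) m.+2 = last_pos l :: mkseq e m.+1.
  by rewrite /mkseq /= -[iota 2 m]/(iota (1 + 1) m) iotaDl -map_comp.
rewrite addr_succ_cons; last first.
  apply/hasP; exists (e m); last exact: em.1.
  by apply: map_f; rewrite mem_iota add0n leqnn.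
have : addr_succ S (mkseq e m.+1) != [::] by exact: addr_succ_neq0.
case: (addr_succ _ _) => [//|q s] _.
rewrite [head _ _]/=.
have -> : mkseq e m.+1 = e 0%N :: behead (mkseq e m.+1) by [].
rewrite !Phi_cons.
rewrite S_last S_first stacked_last phi_last_pos phi_first_pos /kappa -/l.
lra.
Qed.

End Canonical.

(** * Substituted sequences *)

Section Words.
Context {A : finPointedType}.
Variable S : A -> seq A.
Implicit Types (tau : int -> A) (v w : seq A).

Lemma subst_word_cat v w :
  subst_word S (v ++ w) = subst_word S v ++ subst_word S w.
Proof. by rewrite /subst_word map_cat flatten_cat. Qed.

Lemma size_window tau i n : size (window tau i n) = n.
Proof. exact: size_mkseq. Qed.

Lemma window_cat tau i m n :
  window tau i (m + n) = window tau i m ++ window tau (i + m%:Z) n.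
Proof.
rewrite /window /mkseq iotaD map_cat add0n; congr (_ ++ _).
rewrite -{1}[m]addn0 iotaDl -map_comp; apply: eq_map => k /=.
by rewrite PoszD addrA.
Qed.

Lemma window_shift k tau i n :
  window (shift_seq k tau) i n = window tau (i + k) n.
Proof. by apply: eq_map => j; rewrite /shift_seq addrAC. Qed.

Lemma subst_lang_infix v w : infix v w -> subst_lang S w -> subst_lang S v.
Proof. by move=> vw [n [a wna]]; exists n, a; exact: infix_trans vw wna. Qed.

Lemma subst_lang_subst w : subst_lang S w -> subst_lang S (subst_word S w).
Proof.
move=> [n [a /infixP[p [s E]]]]; exists n.+1, a; rewrite iterS E.
by rewrite !subst_word_cat infix_infix.
Qed.

Lemma subshift_shift k tau : subshift S tau -> subshift S (shift_seq k tau).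
Proof. by move=> Stau i n; rewrite window_shift; exact: Stau. Qed.

Hypothesis S_subst : is_substitution S.

Lemma leq_size_subst_word w : (size w <= size (subst_word S w))%N.
Proof.
elim: w => [//|a w IHw]; rewrite /subst_word /= size_cat -add1n leq_add //.
by rewrite lt0n size_eq0.
Qed.

Lemma subst_seq_letter tau k : (k < size (S (tau 0)))%N ->
  subst_seq S tau k%:Z = letter_at S (tau 0, k).
Proof.
move=> kS; rewrite /subst_seq -add1n window_cat subst_word_cat nth_cat.
have -> : subst_word S (window tau 0 1) = S (tau 0).
  by rewrite /window /= /subst_word /= cats0 addr0.
by rewrite kS.
Qed.

(** S(tau) is read off from the substituted central window of tau: its letters
    start at coordinate -|S(tau(-m) ... tau(-1))|, and as |S(v)| >= |v|, all
    coordinates in [-m, m) are covered.  This replaces the case distinction on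
    the sign of the coordinate by one word. *)
Lemma nth_subst_seq tau m k : (k < m + m)%N ->
  subst_seq S tau (k%:Z - m%:Z) =
    nth (tau 0) (subst_word S (window tau (- m%:Z) (m + m)))
      (size (subst_word S (window tau (- m%:Z) m)) - m + k).
Proof.
move=> km; rewrite window_cat subst_word_cat addNr.
set U := subst_word S _; set V := subst_word S _.
have mU : (m <= size U)%N.
  by rewrite -[X in (X <= _)%N](size_window tau (- m%:Z)) leq_size_subst_word.
have [mk|mk] := leqP m k.
  pose j := (k - m)%N.
  have -> : k%:Z - m%:Z = j%:Z by rewrite /j; lia.
  rewrite /subst_seq nth_cat ifF; last by lia.
  have -> : (size U - m + k - size U = j)%N by rewrite /j; lia.
  rewrite /V (_ : m = j.+1 + (m - j.+1))%N; last by rewrite /j; lia.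
  rewrite window_cat subst_word_cat nth_cat ifT //.
  by rewrite (leq_trans _ (leq_size_subst_word _)) // size_window.
pose j := (m - k.+1)%N.
have -> : k%:Z - m%:Z = Negz j by rewrite /j; lia.
rewrite nth_cat ifT; last by lia.
pose X := subst_word S (window tau (- m%:Z) (m - j.+1)).
pose W := subst_word S (window tau (Negz j) j.+1).
have jW : (j.+1 <= size W)%N.
  by rewrite -[X in (X <= _)%N](size_window tau (Negz j)) leq_size_subst_word.
have UE : U = X ++ W.
  rewrite -subst_word_cat (_ : Negz j = - m%:Z + (m - j.+1)%N%:Z) -?window_cat.
    by rewrite subnK // /j; lia.
  by rewrite /j; lia.
rewrite UE size_cat in mU *; have jE : (m = k + j.+1)%N by rewrite /j; lia.
rewrite /subst_seq -/W nth_cat ifF; last by clearbody j X W; lia.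
by congr nth; clearbody j X W; lia.
Qed.

(** A window of S(tau) is a subword of S(v) for a large window v of tau, and the
    language is closed under S and under subwords. *)
Lemma subshift_subst tau : subshift S tau -> subshift S (subst_seq S tau).
Proof.
move=> Stau i n; pose m := (absz i + n)%N.
set w := subst_word S (window tau (- m%:Z) (m + m)).
pose d := (size (subst_word S (window tau (- m%:Z) m)) - m + absz (i + m%:Z)%R)%N.
have w_lang : subst_lang S w by exact: subst_lang_subst.
apply: subst_lang_infix w_lang.
suff -> : window (subst_seq S tau) i n = take n (drop d w).
  exact: infix_trans (infix_take _ _) (infix_drop _ _).
have mU : (m <= size (subst_word S (window tau (- m%:Z) m)))%N.
  by rewrite -[X in (X <= _)%N](size_window tau (- m%:Z)) leq_size_subst_word.
have mV : (m <= size (subst_word S (window tau 0 m)))%N.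
  by rewrite -[X in (X <= _)%N](size_window tau 0) leq_size_subst_word.
have szw : (d + n <= size w)%N.
  rewrite /w window_cat subst_word_cat size_cat addNr /d; move: mU mV.
  move: (size (subst_word S (window tau (- m%:Z) m))) => U.
  by move: (size (subst_word S (window tau 0 m))) => V; rewrite /m; lia.
apply: (@eq_from_nth _ (tau 0)).
  by rewrite size_window size_takel // size_drop; lia.
rewrite size_window => k kn; rewrite nth_mkseq // nth_take // nth_drop.
have -> : i + k%:Z = (absz (i + m%:Z)%R + k)%N%:Z - m%:Z by rewrite /m; lia.
rewrite nth_subst_seq; last by rewrite /m; lia.
by rewrite -/w /d addnA.
Qed.

End Words.

(** * The measures of the cylinders *)

Section Topology.
Context {A : finPointedType}.
Implicit Types (tau : biseq A) (s : seq int).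

#[local] Instance biseq_nbhs_filter (tau : biseq A) : Filter (nbhs tau) :=
  nbhs_filter tau.

Lemma nbhs_agree (tau : biseq A) s :
  nbhs tau [set tau' : biseq A | {in s, tau' =1 tau}].
Proof.
elim: s => [|i s IHs]; first by apply: filterS filterT => tau' _ k.
have ni : nbhs tau [set tau' : biseq A | tau' i = tau i].
  exact: (@proj_continuous int (fun=> discrete_topology A) i tau _
    (discrete_set1 (tau i))).
apply: filterS (filterI ni IHs) => tau' [/= ei es] k.
by rewrite in_cons => /orP[/eqP ->|/es].
Qed.

(** A property that depends on finitely many coordinates is clopen. *)
Lemma closed_local (P : set (biseq A)) s :
  (forall tau tau', {in s, tau' =1 tau} -> P tau -> P tau') -> closed P.
Proof.
move=> Ploc; rewrite -[P]setCK; apply: open_closedC; rewrite openE => tau nP.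
apply: filterS (nbhs_agree tau s) => tau' e P'; apply: nP.
by apply: Ploc P' => k ks; rewrite e.
Qed.

Lemma continuous_local (f : biseq A -> biseq A) :
  (forall i, exists s, forall tau tau', {in s, tau' =1 tau} ->
     f tau' i = f tau i) -> continuous f.
Proof.
move=> floc tau; apply/cvg_sup => i U [V] [[W] oW <-] Wf WU.
apply: (filterS WU); have [s fs] := floc i.
by apply: filterS (nbhs_agree tau s) => tau' /fs /= ->.
Qed.

Lemma biseq_compact : compact [set: biseq A].
Proof.
have := @tychonoff int (fun=> discrete_topology A) (fun=> setT).
rewrite (_ : [set f | _] = setT); first last.
  by apply/seteqP; split.
apply => _; apply: finite_compact; exact: finite_finset.
Qed.

Lemma biseq_hausdorff : hausdorff_space (biseq A).
Proof. by apply: hausdorff_product => ?; exact: discrete_hausdorff. Qed.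

(** Images of Borel sets need not be Borel, but images of compact sets are
    compact; so measurability is obtained from compactness throughout. *)
Lemma compact_measurable (K : set (biseq A)) :
  compact K -> measurable (K : set (biseq_borel A)).
Proof.
move=> /(compact_closed biseq_hausdorff) Kcl.
rewrite -[X in measurable X]setCK; apply: measurableC.
by apply: sub_sigma_algebra; exact: closed_openC.
Qed.

Variable S : A -> seq A.

(** Membership in the subshift is a conjunction of conditions on finite windows,
    hence closed, in a compact space. *)
Lemma letter_cylinder_compact a : compact (letter_cylinder S a : set (biseq A)).
Proof.
apply: (subclosed_compact _ biseq_compact) => //.
have -> : (letter_cylinder S a : set (biseq A)) =
    \bigcap_(p in [set: int * nat]) [set tau | subst_lang S (window tau p.1 p.2)]
    `&` [set tau | tau 0 = a].
  apply/seteqP; split => tau [Stau t0]; split => //.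
    by move=> [i n] _; exact: Stau.
  by move=> i n; exact: (Stau (i, n)).
apply: closedI.
  apply: closed_bigI => -[i n] _ /=.
  apply: (@closed_local _ [seq i + k%:Z | k <- iota 0 n]) => tau tau' e /=.
  congr (subst_lang S _); apply/eq_in_map => k kn; apply/esym/e.
  exact: (map_f (fun k : nat => i + k%:Z)).
apply: (@closed_local _ [:: 0]) => tau tau' e /= <-; apply: e.
exact: mem_head.
Qed.

Lemma shift_seq_continuous k :
  continuous (shift_seq k : biseq A -> biseq A).
Proof.
apply: continuous_local => i; exists [:: i + k] => tau tau' e.
by apply: e; exact: mem_head.
Qed.

Lemma subst_seq_continuous : continuous (subst_seq S : biseq A -> biseq A).
Proof.
have window_eq tau tau' i n : {in [seq i + k%:Z | k <- iota 0 n], tau' =1 tau} ->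
    window tau' i n = window tau i n.
  move=> e; apply/eq_in_map => k kn; apply: e.
  exact: (map_f (fun k : nat => i + k%:Z)).
apply: continuous_local => i.
pose n := if i is Negz n then n.+1 else (absz i).+1.
pose l := if i is Negz _ then i else 0.
exists (0 :: [seq l + k%:Z | k <- iota 0 n]) => tau tau' e.
have e0 : tau' 0 = tau 0 by apply: e; exact: mem_head.
have {e}/window_eq e : {in [seq l + k%:Z | k <- iota 0 n], tau' =1 tau}.
  by move=> k ks; apply: e; rewrite in_cons ks orbT.
by move: e; rewrite /n /l /subst_seq; case: i {n l} => n /= ->; rewrite e0.
Qed.

End Topology.

Section Weights.
Context {A : finPointedType} {R : realType}.
Variable S : A -> seq A.
Variable mu : probability (biseq_borel A) R.
Variable lambda : R.

Hypothesis S_subst : is_substitution S.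
Hypothesis S_recognizable : recognizable S.
Hypothesis mu_supp : mu (subshift S) = 1%E.
Hypothesis mu_inv : shift_invariant mu.
Hypothesis mu_scale : forall a : A,
  mu (subst_seq S @` letter_cylinder S a) = (weight S mu a / lambda)%:E.

Lemma letter_cylinder_measurable a :
  measurable (letter_cylinder S a : set (biseq_borel A)).
Proof. by apply: compact_measurable; exact: letter_cylinder_compact. Qed.

Lemma mu_letter_cylinder a : mu (letter_cylinder S a) = (weight S mu a)%:E.
Proof.
by rewrite /weight fineK // fin_num_measure //; exact: letter_cylinder_measurable.
Qed.

Lemma sum_weight : \sum_a weight S mu a = 1.
Proof.
apply: EFin_inj; rewrite -mu_supp -sumEFin.
have -> : (subshift S : set (biseq_borel A)) =
    \bigcup_(a in [set` index_enum A]) letter_cylinder S a.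
  apply/seteqP; split => tau; last by move=> [a _ []].
  by move=> Stau; exists (tau 0) => //=; rewrite mem_index_enum.
rewrite measure_fin_bigcup //; last first.
- by move=> a _; exact: letter_cylinder_measurable.
- by move=> a b _ _ [tau [[_ <-] [_ <-]]].
rewrite -fsbig_seq ?index_enum_uniq //.
by apply: eq_bigr => a _; exact/esym/mu_letter_cylinder.
Qed.

(** sigma^j(S([beta])) for p = (beta, j), a floor of the Kakutani-Rokhlin towers
    over the sets S([beta]). *)
Definition tower_floor (p : A * nat) : set (int -> A) :=
  shift_seq p.2%:Z @` (subst_seq S @` letter_cylinder S p.1).

Lemma tower_floor_compact p : compact (tower_floor p : set (biseq A)).
Proof.
apply: (@continuous_compact (biseq A) (biseq A) (shift_seq p.2%:Z)).
  by apply: continuous_subspaceT; exact: shift_seq_continuous.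
apply: (@continuous_compact (biseq A) (biseq A) (subst_seq S)).
  by apply: continuous_subspaceT; exact: subst_seq_continuous.
exact: letter_cylinder_compact.
Qed.

Lemma tower_floor_measurable p :
  measurable (tower_floor p : set (biseq_borel A)).
Proof. by apply: compact_measurable; exact: tower_floor_compact. Qed.

(** Each floor is the inverse image under sigma of the next one, because sigma is
    invertible; as the next floor is measurable, invariance applies. *)
Lemma mu_tower_floor a j : mu (tower_floor (a, j)) = (weight S mu a / lambda)%:E.
Proof.
elim: j => [|j <-].
  rewrite -mu_scale; congr (mu _); rewrite /tower_floor /=.
  rewrite -[RHS]image_id; apply: eq_imagel => tau _.
  by apply/funext => i; rewrite /shift_seq addr0.
rewrite -mu_inv; last exact: tower_floor_measurable.
congr (mu _); apply/seteqP; split => tau; rewrite /tower_floor /=.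
  move=> [t tS tE]; exists t => //; apply/funext => i.
  have := congr1 (fun f : int -> A => f (i - 1)) tE.
  rewrite /shift_seq /= subrK => <-; congr (t _); lia.
move=> [t tS <-]; exists t => //; apply/funext => i; rewrite /shift_seq.
by congr (t _); lia.
Qed.

(** Existence in recognizability gives one inclusion; the other one holds because
    the subshift is stable under S and under the shift. *)
Lemma letter_cylinder_floors (s : seq (A * nat)) a :
  (forall p, (p \in s) = is_occurrence S a p) ->
  letter_cylinder S a = \bigcup_(p in [set` s]) tower_floor p.
Proof.
move=> sP; apply/seteqP; split => tau.
  move=> [Stau t0]; have [[t k] [[/= St kS tauE] _]] := S_recognizable Stau.
  have kS' : (k < size (S (t 0)))%N.
    by move: kS; have := S_subst (t 0); case: (S (t 0)).
  exists (t 0, k); last by exists (subst_seq S t) => //; exists t.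
  rewrite /= sP /is_occurrence /is_position kS' -(subst_seq_letter kS').
  by rewrite -t0 tauE /shift_seq add0r eqxx.
move=> [[b j] /=]; rewrite sP => /andP[bj /eqP ba].
move=> [_ [t [St t0] <-] <-]; split.
  exact/subshift_shift/subshift_subst.
rewrite /shift_seq add0r subst_seq_letter // ?t0 //.
Qed.

(** Uniqueness in recognizability: a point determines both tau and j. *)
Lemma tower_floor_trivIset (D : set (A * nat)) :
  (forall p, D p -> is_position S p) -> trivIset D tower_floor.
Proof.
move=> DP p q Dp Dq [tau [[_ [t [St t0] <-] tE] [_ [t' [St' t'0] <-] t'E]]].
have Stau : subshift S tau.
  by rewrite -tE; exact/subshift_shift/subshift_subst.
have [r [_ r_uniq]] := S_recognizable Stau.
have pos u : D u -> (u.2 <= (size (S u.1)).-1)%N.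
  by move=> /DP; rewrite /is_position; case: (size _).
have rp := r_uniq (t, p.2); have rq := r_uniq (t', q.2).
have : (t, p.2) = (t', q.2).
  rewrite -rp; last by split => //=; rewrite t0 pos.
  by rewrite -rq //; split => //=; rewrite t'0 pos.
move=> [tt' pq]; rewrite [p]surjective_pairing [q]surjective_pairing pq.
by rewrite -t0 -t'0 tt'.
Qed.

Lemma sum_occurrences (ord : A -> seq (A * nat)) :
  ordering_of_occurrences S ord ->
  forall a, \sum_(q <- ord a) weight S mu q.1 / lambda = weight S mu a.
Proof.
move=> ordP a; have [ord_uniq ordE] := ordP a.
apply: EFin_inj; rewrite -mu_letter_cylinder (letter_cylinder_floors ordE).
rewrite measure_fin_bigcup //; last first.
- by move=> p _; exact: tower_floor_measurable.
- by apply: tower_floor_trivIset => p /=; rewrite ordE => /andP[].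
- exact: finite_seq.
rewrite -fsbig_seq // -sumEFin; apply: eq_bigr => -[b j] _.
exact/esym/mu_tower_floor.
Qed.

End Weights.

(** * The functional equation *)

Theorem proposition4p8 (R : realType) (A : finPointedType) (S : A -> seq A)
  (lambda : R) (mu : probability (biseq_borel A) R)
  (S_subst : is_substitution S)
  (S_recognizable : recognizable S)
  (S_proper : proper_subst S)
  (S_minimal : minimal_subshift S)
  (S_size : forall a : A, (1 < size (S a))%N)
  (lambda_PF : perron_frobenius_eigenvalue (subst_matrix S R) lambda)
  (lambda_gt1 : 1 < lambda)
  (mu_supp : mu (subshift S) = 1%E)
  (mu_inv : shift_invariant mu)
  (mu_gt0 : forall a : A, (0 < mu (letter_cylinder S a))%E)
  (mu_scale : forall (a : A) (n : nat),
     mu (iter n (subst_seq S) @` letter_cylinder S a)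
       = (weight S mu a / lambda ^+ n)%:E) :
  exists (D : set R) (F : R -> R),
    canonical_iiet S mu lambda D F /\
    exists kappa : R, 0 <= kappa < 1 /\
      {ae lebesgue_measure, forall x : R, 0 <= x <= 1 ->
        [/\ D x, D (x / lambda)
          & F x = lambda * (F (x / lambda) - kappa)]}.
Proof.
have [b [c S_bc]] := S_proper.
have S_first a : letter_at S (a, 0%N) = b.
  by have [u [_ [Sa _]]] := S_bc a; rewrite /letter_at /= Sa.
have S_last a : letter_at S (a, (size (S a)).-1) = c.
  by have [_ [v [_ Sa]]] := S_bc a; rewrite /letter_at /= nth_last Sa last_rcons.
have lambda_gt0 : 0 < lambda by exact: lt_trans ltr01 lambda_gt1.
have w_gt0 a : 0 < weight S mu a.
  by rewrite -lte_fin -mu_letter_cylinder.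
have w_ge0 a : 0 <= weight S mu a by exact: ltW.
have sum_w : \sum_a weight S mu a = 1 by exact: sum_weight.
have mu_scale1 a :
    mu (subst_seq S @` letter_cylinder S a) = (weight S mu a / lambda)%:E.
  by rewrite -[lambda]expr1 -(mu_scale a 1%N).
pose Phi0 := stacked S mu c; pose ord := sorted_occurrences S c.
have Phi0_partition : letter_partition S mu Phi0.
  exact: stacked_partition.
have ord_ordering : ordering_of_occurrences S ord.
  exact: sorted_occurrences_ordering.
have sum_ord a : \sum_(q <- ord a) weight S mu q.1 / lambda = weight S mu a.
  exact: sum_occurrences.
have iietE x y : iiet_graph S mu lambda Phi0 ord x y ->
    iiet S mu lambda Phi0 ord x = y.
  move=> xy; apply: (iiet_graph_unique S_size lambda_gt1 w_gt0 sum_w sum_ord _ xy).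
  exact: (xgetPex 0 (ex_intro _ y xy)).
exists (iiet_dom S mu lambda Phi0 ord), (iiet S mu lambda Phi0 ord).
split; first by exists Phi0, ord.
exists (kappa S mu lambda b c); split.
  exact: kappa_itv.
have inner x : 0 < x < 1 ->
    [/\ iiet_dom S mu lambda Phi0 ord x,
        iiet_dom S mu lambda Phi0 ord (x / lambda)
      & iiet S mu lambda Phi0 ord x =
        lambda * (iiet S mu lambda Phi0 ord (x / lambda)
                  - kappa S mu lambda b c)].
  move=> /andP[x0 x1]; have x01 : 0 <= x < 1 by rewrite ltW.
  have [e xe] := address_exists lambda_gt0 Phi0_partition ord_ordering sum_ord x01.
  have [m em] : exists m, first_not_last S e m.
    by apply: first_not_last_exists xe _; rewrite ?gt_eqF.
  have [y xy] : iiet_dom S mu lambda Phi0 ord x.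
    by eexists; exists e, m; split; [| | |reflexivity].
  have xy' := iiet_graph_div S_size S_first S_last lambda_gt1 w_gt0 sum_w sum_ord xy.
  split; [by exists y|by eexists; exact: xy'|].
  by rewrite (iietE _ _ xy) (iietE _ _ xy') addrK mulrC divfK ?gt_eqF.
(* 0 has no increasable entry in its address, and 1 lies outside [0, 1). *)
exists [set 0; 1]; split.
- by apply: measurableU; exact: measurable_set1.
- apply: countable_lebesgue_measure0.
  by apply: finite_set_countable; exact: finite_set2.
move=> x /=; apply: contra_notP => /not_orP[x0 x1] /andP[x_ge0 x_le1].
by apply: inner; rewrite !lt_neqAle x_ge0 x_le1 !andbT eq_sym; apply/andP; split;
  apply/eqP.
Qed.
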